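(* Let $g\ge 3$, $k\ge 0$, let $m,n\ge 1$ be odd integers, and let $\alpha,\beta$ be non-negative integers. An $RSM_\Gamma(\Gamma,g;[\,^{\alpha}m,\ ^{\beta}2^kn])$ exists if and only if $\alpha+\beta=2^{k+2}mn$, except possibly in the following cases: (1) $k\ge 2$ and $\beta=0$; or (2) $k=1$ and $\alpha\in\{0,2,4\}$ or $\beta\in\{0,2,4\}$.
   Context: Let $G=\mathbb{Z}_m\times\mathbb{Z}_{2^{k+1}n}$ and let $\Gamma$ be the generalized dihedral group on $G$: underlying set $G\times\mathbb{Z}_2$ with operation $(x,\tau)+(x',\tau')=(x+(-1)^\tau x',\tau+\tau')$. $[\,^{a}x,\,^{b}y]$ denotes the multiset with $a$ copies of $x$ and $b$ copies of $y$. For $S\subseteq\Gamma$ and a list $L$ of positive integers of length $|S|$, an $RSM_\Gamma(S,g;L)$ is an $|S|\times g$ matrix with entries in $\Gamma$ such that each column is a permutation (arrangement) of $S$ and the multiset of orders (in $\Gamma$) of the left-to-right row sums equals $L$. *)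

(* Defs.v *)
From mathcomp Require Import all_boot all_order all_algebra.
Set Implicit Arguments. Unset Strict Implicit. Unset Printing Implicit Defensive.
Import GRing.Theory.


(* The generalized dihedral group on G: underlying set G x Z_2 *)
Definition Gam (m N : nat) : finType := (('I_m.-1.+1 * 'I_N.-1.+1) * bool)%type.

Definition dih_op (m N : nat) (p q : Gam m N) : Gam m N :=
  let: ((a, b), t) := p in
  let: ((a', b'), t') := q in
  (((a + (if t then - a' else a'))%R, (b + (if t then - b' else b'))%R), addb t t').

Definition dih_zero (m N : nat) : Gam m N := ((0%R, 0%R), false).

Definition dih_mul (m N : nat) (p : Gam m N) (j : nat) : Gam m N :=
  iter j (dih_op p) (dih_zero m N).

(* order of p in Gamma: the least j >= 1 with j p = 0 (it is at most |Gamma|) *)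
Definition dih_order (m N : nat) (p : Gam m N) : nat :=
  (find (fun j => dih_mul p j.+1 == dih_zero m N) (iota 0 #|Gam m N|)).+1.

Definition dih_sum (m N : nat) (s : seq (Gam m N)) : Gam m N :=
  foldl (@dih_op m N) (dih_zero m N) s.

Definition RSM (m N : nat) (S : {set Gam m N}) (g : nat) (L : seq nat) : Prop :=
  exists A : 'I_#|S| -> 'I_g -> Gam m N,
    (forall j : 'I_g, perm_eq [seq A i j | i <- enum 'I_#|S|] (enum S)) /\
    perm_eq [seq dih_order (dih_sum [seq A i j | j <- enum 'I_g])
            | i <- enum 'I_#|S|] L.

(* Main.v *)
Require Import Defs.
From HB Require Import structures.
From mathcomp Require Import all_boot all_order all_algebra all_fingroup zify.
Set Implicit Arguments. Unset Strict Implicit. Unset Printing Implicit Defensive.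
Import GRing.Theory.

(* Write h = 2^k n, N = 2h and G = Z_m x Z_N. The group Gamma has a complete
   mapping, i.e. permutations a, b with a(x) b(x) = x for all x; splitting a
   column c into a o c and b o c passes from g columns to g + 1, so g = 3
   suffices.

   For g = 3 the products of the first two columns run over Gamma, and the third
   column turns a bijection x |-> x + e(x) of G into a block of row sums e(x),
   once over the rotations and once over the reflections. Any even number of the
   e(x) can be taken to be (1,0) or (-1,0), of order m, and the others (0,2) or
   (0,-2), of order h: shift the rows Z_m x {y} or the columns {x} x Z_N
   alternately forwards and backwards, then exchange images within disjoint pairs.

   For odd alpha, each block would need an even number of row sums of order m.
   This parity obstruction is removed by altering three rows of the complete
   mapping so that exactly one product changes, a rotation q becoming
   q + (-8,2): the row sum (0,-2) in that row becomes (-8,0), of order m as m is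
   odd. *)

(** * Row-sum matrices from permutations *)

Lemma perm_eq_two_values (T : Type) (p : pred T) (a b : nat) (s : seq T) :
  perm_eq [seq if p x then a else b | x <- s]
          (nseq (count p s) a ++ nseq (size s - count p s) b).
Proof.
elim: s => //= x s IH; case: (p x) => /=.
  by rewrite add1n subSS perm_cons.
rewrite add0n subSn ?count_size //=.
by rewrite -cat1s -[_ :: nseq _ b]cat1s perm_sym perm_catCA perm_cat2l perm_sym.
Qed.

(** [enum_val] indexes the rows by the elements of the group, so that a column becomes a permutation
    and the row sums a function on the group. *)
Lemma RSM_of_perms (m N g : nat) (cs : g.-tuple {perm Gam m N})
    (p : pred (Gam m N)) (a b : nat) :
  (forall x, dih_order (dih_sum [seq (c : {perm Gam m N}) x | c <- cs])
             = if p x then a else b) ->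
  RSM [set: Gam m N] g (nseq #|p| a ++ nseq (#|Gam m N| - #|p|) b).
Proof.
move=> csP; exists (fun i j => tnth cs j (enum_val i)).
have all_rows : perm_eq [seq enum_val i | i <- enum 'I_#|[set: Gam m N]|]
                        (enum [set: Gam m N]).
  apply: uniq_perm; rewrite ?enum_uniq //.
    by rewrite map_inj_uniq ?enum_uniq //; apply: enum_val_inj.
  move=> x; rewrite mem_enum inE; apply/mapP.
  by exists (enum_rank_in (in_setT x) x); rewrite ?mem_enum // enum_rankK_in.
split=> [j|].
  rewrite (map_comp (tnth cs j) enum_val).
  apply: (perm_trans (perm_map _ all_rows)).
  apply: uniq_perm; rewrite ?enum_uniq //.
    by rewrite map_inj_uniq ?enum_uniq //; apply: perm_inj.
  move=> x; rewrite mem_enum inE; apply/mapP.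
  by exists ((tnth cs j)^-1%g x); rewrite ?mem_enum ?inE ?permKV.
under eq_map => i.
  rewrite (map_comp (fun c : {perm Gam m N} => c (enum_val i)) (tnth cs)).
  rewrite map_tnth_enum csP; over.
rewrite (map_comp (fun x => if p x then a else b) enum_val).
apply: (perm_trans (perm_map _ all_rows)).
have -> : #|p| = count p (enum [set: Gam m N]).
  by rewrite enum_setT -enumT -sum1_card -sum1_count big_enum_cond.
by rewrite -cardsT cardE perm_eq_two_values.
Qed.

(** * Orders of rotations *)

Lemma dih_mul_rotation (m N j : nat) (x : 'I_m.-1.+1) (y : 'I_N.-1.+1) :
  dih_mul (((x, y), false) : Gam m N) j = ((x *+ j, y *+ j), false)%R.
Proof. by elim: j => //= j ->; rewrite /= !mulrS. Qed.

(** [dih_order] searches only up to the order of the group; the bound on [d] puts the first hit, at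
    index [d - 1], inside that range. *)
Lemma dih_order_eq (m N d : nat) (p : Gam m N) :
  0 < d <= #|Gam m N| ->
  (forall j, (dih_mul p j == dih_zero m N) = (d %| j)) -> dih_order p = d.
Proof.
case/andP=> d_gt0 d_le dP; rewrite /dih_order.
have -> : find (fun j => dih_mul p j.+1 == dih_zero m N) (iota 0 #|Gam m N|)
          = find (fun j => d %| j.+1) (iota 0 #|Gam m N|).
  by apply: eq_find => j; rewrite dP.
case: d d_gt0 d_le {dP} => // d _ d_le.
rewrite -(subnKC d_le) addSnnS iotaD find_cat.
have -> : has (fun j => d.+1 %| j.+1) (iota 0 d) = false.
  apply/hasPn => j; rewrite mem_iota /= add0n => lt_jd.
  by rewrite gtnNdvd.
by rewrite size_iota /= add0n dvdnn addn0.
Qed.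

Lemma inZp_mulrn (p c j : nat) : (inZp c *+ j = inZp (c * j) :> 'I_p.+1)%R.
Proof. by rewrite Zp_mulrn; apply: val_inj; rewrite /= modnMml. Qed.

Lemma inZp_eq0 (p c : nat) : ((inZp c : 'I_p.+1) == 0%R) = (p.+1 %| c).
Proof. by []. Qed.

Lemma inZpD (p a b : nat) : (inZp (a + b) = inZp a + inZp b :> 'I_p.+1)%R.
Proof. by apply: val_inj; rewrite /= modnDm. Qed.

Lemma card_Gam (m N : nat) : 0 < m -> 0 < N -> #|Gam m N| = m * N * 2.
Proof. by move=> m_gt0 N_gt0; rewrite !card_prod !card_ord card_bool !prednK. Qed.

(** * Bijections of G with prescribed displacements *)

(* The new map is [x |-> x + e x] precomposed with the involution exchanging [x]
   and [x + w] for every [x] in [F]. *)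
Lemma flip_inj (V : finZmodType) (e : V -> V) (w : V) (F : {set V}) :
  injective (fun x => x + e x)%R -> {in F, forall x, (x + w)%R \notin F} ->
  injective (fun x => x + (if x \in F then w + e (x + w)
                           else if x - w \in F then e (x - w) - w else e x))%R.
Proof.
move=> e_inj F_w.
pose tau x := (if x \in F then x + w else if x - w \in F then x - w else x)%R.
have tauK : involutive tau.
  move=> x; rewrite {2}/tau; case: ifP => [xF|xF].
    by rewrite /tau (negPf (F_w _ xF)) addrK xF.
  case: ifP => [xwF|xwF]; last by rewrite /tau xF xwF.
  by rewrite /tau xwF subrK.
apply: (eq_inj (inj_comp e_inj (inv_inj tauK))) => x /=.
rewrite /tau; case: ifP => _; first by rewrite addrA.
by case: ifP => // _; rewrite [(e _ - w)%R]addrC addrA.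
Qed.

Lemma card_flip (V : finZmodType) (w : V) (F : {set V}) :
  {in F, forall x, (x + w)%R \notin F} ->
  #|[set x | (x \in F) || ((x - w)%R \in F)]| = #|F|.*2.
Proof.
move=> F_w.
have -> : [set x | (x \in F) || ((x - w)%R \in F)]
          = F :|: [set (x + w)%R | x in F].
  apply/setP => x; rewrite !inE; congr (_ || _).
  apply/idP/imsetP => [xF|[y yF ->]]; last by rewrite addrK.
  by exists (x - w)%R; rewrite ?subrK.
rewrite cardsU card_imset; last exact: addIr.
rewrite addnn (_ : _ :&: _ = set0) ?cards0 ?subn0 //.
apply/setP => x; rewrite !inE; apply/negP => /andP[xF /imsetP[y yF def_x]].
by move: xF; rewrite def_x (negPf (F_w _ yF)).
Qed.

(** Joins the additive and the finite structure of a product, so that G becomes a [finZmodType]. *)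
HB.instance Definition _ (U V : finZmodType) := GRing.Zmodule.on (U * V)%type.

Definition rot_group (m N : nat) : finZmodType := ('I_m.-1.+1 * 'I_N.-1.+1)%type.

Definition first_gen (m N c : nat) : rot_group m N := (inZp c, 0%R).
Definition second_gen (m N c : nat) : rot_group m N := (0%R, inZp c).

(** Used with [c = 1] for ordinary displacements and with [c = 8] for the row sum altered when
    [alpha] is odd. *)
Lemma order_first_gen (m N c : nat) :
  0 < m -> 0 < N -> coprime m c ->
  dih_order ((first_gen m N c, false) : Gam m N) = m /\
  dih_order ((- first_gen m N c, false)%R : Gam m N) = m.
Proof.
move=> m_gt0 N_gt0 co_mc; split; apply: dih_order_eq; rewrite ?card_Gam ?m_gt0 //=;
  try nia; move=> j; rewrite dih_mul_rotation !xpair_eqE !andbT.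
  by rewrite mul0rn eqxx andbT inZp_mulrn inZp_eq0 prednK // Gauss_dvdr.
rewrite oppr0 mul0rn eqxx andbT mulNrn oppr_eq0.
by rewrite inZp_mulrn inZp_eq0 prednK // Gauss_dvdr.
Qed.

Lemma order_second_gen (m h : nat) :
  0 < m -> 0 < h ->
  dih_order ((second_gen m h.*2 2, false) : Gam m h.*2) = h /\
  dih_order ((- second_gen m h.*2 2, false)%R : Gam m h.*2) = h.
Proof.
move=> m_gt0 h_gt0; have N_gt0 : 0 < h.*2 by lia.
split; apply: dih_order_eq; rewrite ?card_Gam ?h_gt0 //=;
  try nia; move=> j; rewrite dih_mul_rotation !xpair_eqE !andbT.
  by rewrite mul0rn eqxx inZp_mulrn inZp_eq0 prednK // -mul2n dvdn_pmul2l.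
rewrite oppr0 mul0rn eqxx mulNrn oppr_eq0.
by rewrite inZp_mulrn inZp_eq0 prednK // -mul2n dvdn_pmul2l.
Qed.

Lemma exists_subset_card (T : finType) (P : {set T}) (r : nat) :
  r <= #|P| -> exists2 F : {set T}, F \subset P & #|F| = r.
Proof.
case/card_geqP => s [s_uniq s_size sP]; exists [set x in s].
  by apply/subsetP => x; rewrite inE => /sP.
by rewrite cardsE (card_uniqP s_uniq).
Qed.

(* Shifting by [v] where [alt] fails and by [-v] where it holds is a bijection;
   each pair [x], [x + u + v] with [x] in [P] can be flipped independently to
   the displacements [u] and [-u]. *)
Lemma flip_alternating (V : finZmodType) (alt : pred V) (P : {set V}) (u v : V)
    (r : nat) :
  (forall x, alt (x + v)%R = alt x) ->
  {in P, forall x, ~~ alt x && alt (x + (u + v))%R} -> r <= #|P| ->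
  exists (e : V -> V) (F : {set V}),
    [/\ injective (fun x => x + e x)%R, F \subset P, #|F| = r,
        #|[set x | (x \in F) || ((x - (u + v))%R \in F)]| = r.*2 &
        forall x, e x = if x \in F then u else
                        if (x - (u + v))%R \in F then (- u)%R else
                        if alt x then (- v)%R else v].
Proof.
move=> alt_v P_alt /exists_subset_card[F /subsetP FP card_F].
have alt_inj : injective (fun x => x + (if alt x then - v else v))%R.
  move=> x y E; have alt_shift z : alt (z + (if alt z then - v else v))%R = alt z.
    by case: ifP => alt_z; rewrite -?alt_z -[LHS]alt_v ?subrK ?alt_v.
  have eq_alt : alt x = alt y by rewrite -alt_shift E alt_shift.
  by apply: (addIr (if alt y then - v else v)%R); rewrite -{1}eq_alt.
have F_w : {in F, forall x, (x + (u + v))%R \notin F}.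
  move=> x xF; apply/negP => xwF.
  by case/andP: (P_alt _ (FP _ xF)) => _; case/andP: (P_alt _ (FP _ xwF)) => /negPf->.
have := flip_inj alt_inj F_w; set e := (fun x => (x + _)%R) => e_inj.
exists (fun x => if x \in F then u else
        if (x - (u + v))%R \in F then (- u)%R else
        if alt x then (- v)%R else v), F; split=> //.
- apply: eq_inj e_inj _ => x; rewrite /e; congr (_ + _)%R.
  case: ifP => [xF|_].
    by case/andP: (P_alt _ (FP _ xF)) => _ ->; rewrite addrK.
  case: ifP => // xwF.
  by case/andP: (P_alt _ (FP _ xwF)) => /negPf-> _; rewrite opprD addrC addrNK.
- exact/subsetP.
- by rewrite card_flip ?card_F.
Qed.

Lemma val_addZp (q : nat) (x : 'I_q.-1.+1) (c : nat) :
  x + c < q -> val (x + inZp c)%R = x + c.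
Proof. by move=> lt_xc; rewrite /= modnDmr modn_small //; lia. Qed.

(** For small [r], start from displacements [v] and [-v] and flip [r] pairs to [u] and [-u]. For
    large [r], start from [u] and [-u] and flip the remaining [m * h - r] pairs to [v] and [-v]. The
    last conclusion supplies the row that is altered for odd [alpha]. *)
Lemma displacement_block (m h r : nat) :
  odd m -> 0 < h -> r.*2 <= m * h.*2 ->
  exists (e : rot_group m h.*2 -> rot_group m h.*2) (p : {set rot_group m h.*2}),
    [/\ injective (fun x => x + e x)%R,
        forall x, dih_order ((e x, false) : Gam m h.*2) = if x \in p then m else h,
        #|p| = r.*2 &
        r.*2 < m * h.*2 ->
        exists2 x, x \notin p & e x = (- second_gen m h.*2 2)%R].
Proof.
move=> odd_m h_gt0 le_r; have m_gt0 := odd_gt0 odd_m.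
have N_gt0 : 0 < h.*2 by lia.
set u := first_gen m h.*2 1; set v := second_gen m h.*2 2.
have [ord_u ord_Nu] := order_first_gen m_gt0 N_gt0 (coprimen1 m).
have [ord_v ord_Nv] := order_second_gen m_gt0 h_gt0.
case: (leqP r (m./2 * h.*2)) => [le_r_rows|gt_r_rows].
(* As [m] is odd, [m - 1] and 0 are both even: adding 1 to the last representative does not change
   [alt], so [P] leaves it out. *)
- pose alt (x : rot_group m h.*2) := odd (x.1 : 'I_m.-1.+1).
  pose P := [set x : rot_group m h.*2 | ~~ alt x & (x.1 : 'I_m.-1.+1).+1 < m].
  have alt_v x : alt (x + - v)%R = alt x.
    by rewrite /alt; congr (odd (nat_of_ord _)); rewrite /= oppr0 addr0.
  have P_alt : {in P, forall x, ~~ alt x && alt (x + (u + - v))%R}.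
    move=> x; rewrite inE /alt => /andP[alt_x lt_x]; rewrite alt_x andTb.
    have -> : (x + (u + - v)).1%R = (x.1 + inZp 1)%R by rewrite /= oppr0 addr0.
    rewrite [nat_of_ord _]val_addZp; last by rewrite addn1.
    by rewrite addn1 /= alt_x.
  have card_P : m./2 * h.*2 <= #|P|.
    pose f (z : 'I_m./2 * 'I_h.*2) : rot_group m h.*2 := (inZp z.1.*2, inZp z.2).
    have f_inj : injective f.
      move=> [[x1 lt_x1] [x2 lt_x2]] [[y1 lt_y1] [y2 lt_y2]] [] /=.
      rewrite !modn_small; try lia.
      by move=> ? ?; apply/eqP; rewrite xpair_eqE -!val_eqE /=; lia.
    have -> : m./2 * h.*2 = #|f @: setT|.
      by rewrite (card_imset _ f_inj) cardsT card_prod !card_ord.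
    apply/subset_leq_card/subsetP => _ /imsetP[[[x lt_x] y] _ ->].
    rewrite inE /alt /= modn_small; lia.
  have [e [F [e_inj FP card_F card_p eP]]] :=
    flip_alternating (V := rot_group m h.*2) alt_v P_alt (leq_trans le_r_rows card_P).
  exists e, [set x | (x \in F) || ((x - (u + - v))%R \in F)]; split=> //.
    move=> x; rewrite eP inE opprK; case: ifP => //= _; case: ifP => // _.
    by case: ifP.
  (* The representative [m - 1] is even and has no partner. Since [flip_alternating] is applied with
     [- v], this point keeps the displacement [- v]. *)
  move=> _; pose x0 : rot_group m h.*2 := (inZp m.-1, 0%R).
  have val_x0 : (x0.1 : 'I_m.-1.+1) = m.-1 :> nat by rewrite /= modn_small.
  have alt_x0 : alt x0 = false by rewrite /alt val_x0; lia.
  have x0F : x0 \notin F.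
    by apply/negP => /(subsetP FP); rewrite inE val_x0; lia.
  have x0wF : (x0 - (u + - v))%R \notin F.
    apply/negP => /(subsetP FP)/P_alt.
    by rewrite subrK alt_x0 andbF.
  exists x0; first by rewrite inE negb_or x0F.
  by rewrite eP (negPf x0F) (negPf x0wF) alt_x0.
pose alt (x : rot_group m h.*2) := odd (x.2 : 'I_h.*2.-1.+1)./2.
pose P := [set x : rot_group m h.*2 | ~~ alt x & (x.2 : 'I_h.*2.-1.+1).+2 < h.*2].
have alt_u x : alt (x + u)%R = alt x.
  by rewrite /alt; congr (odd (nat_of_ord _)./2); rewrite /= addr0.
have P_alt : {in P, forall x, ~~ alt x && alt (x + (v + u))%R}.
  move=> x; rewrite inE /alt => /andP[alt_x lt_x]; rewrite alt_x andTb.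
  have -> : (x + (v + u)).2%R = (x.2 + inZp 2)%R by rewrite /= addr0.
  rewrite [nat_of_ord _]val_addZp; last by rewrite addn2.
  by rewrite addn2 /= alt_x.
have card_P : h.-1 <= #|P|.
  (* Fewer than [h] pairs remain to be flipped, so points with first coordinate 0 suffice; their
     second coordinates are 0 or 1 modulo 4. *)
  pose f (z : 'I_h.-1) : rot_group m h.*2 := (0%R, inZp (z./2 * 4 + odd z)).
  have f_inj : injective f.
    move=> [x lt_x] [y lt_y] [] /=; rewrite !modn_small; try lia.
    by move=> ?; apply: val_inj => /=; lia.
  have -> : h.-1 = #|f @: setT| by rewrite (card_imset _ f_inj) cardsT card_ord.
  apply/subset_leq_card/subsetP => _ /imsetP[[x lt_x] _ ->].
  rewrite inE /alt /= modn_small; lia.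
have le_s : h * m - r <= h.-1 by nia.
have [e [F [e_inj FP card_F card_p eP]]] :=
    flip_alternating (V := rot_group m h.*2) alt_u P_alt (leq_trans le_s card_P).
exists e, (~: [set x | (x \in F) || ((x - (v + u))%R \in F)]); split=> //.
- move=> x; rewrite eP !inE; case: ifP => //= _; case: ifP => //= _.
  by case: ifP.
- rewrite cardsCs setCK card_p card_prod !card_ord; nia.
move=> lt_r; have /card_gt0P[x xF] : 0 < #|F| by rewrite card_F; nia.
have xwF : (x + (v + u))%R \notin F.
  apply/negP => xwF; have /andP[_ +] := P_alt _ (subsetP FP _ xF).
  by have /andP[/negPf-> _] := P_alt _ (subsetP FP _ xwF).
exists (x + (v + u))%R; first by rewrite !inE addrK xF orbT.
by rewrite eP addrK xF (negPf xwF).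
Qed.

(** * Complete and nearly complete mappings *)

(** By cardinality [p] is a bijection, and [s] is [a] after its inverse. This reindexes a table of
    rows by the products of the rows. *)
Lemma perm_between_inj (J T : finType) (p a : J -> T) :
  #|T| <= #|J| -> injective p -> injective a ->
  exists s : {perm T}, forall j, s (p j) = a j.
Proof.
move=> le_TJ p_inj a_inj; have [q pK qK] := inj_card_bij p_inj le_TJ.
have aq_inj : injective (a \o q) by apply: inj_comp a_inj (can_inj qK).
by exists (perm aq_inj) => j; rewrite permE /= pK.
Qed.

(** Rows of an explicit complete mapping. The bit [t] picks the half of [Z_2h] in the left entry,
    [o] picks it in the right entry, and in the product [2i + o] runs over all of [Z_2h], shifted by
    [t * h]. *)
Definition row_index (m h : nat) : finType := ('I_m.-1.+1 * 'I_h * bool * bool)%type.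

Definition row_left (m h : nat) (j : row_index m h) : Gam m h.*2 :=
  let: (x, i, t, o) := j in ((x, inZp (t * h + i)), o).
Definition row_right (m h : nat) (j : row_index m h) : Gam m h.*2 :=
  let: (x, i, t, o) := j in
  ((if o then - x else x, if o then - inZp i.+1 else inZp i)%R, t (+) o).
Definition row_prod (m h : nat) (j : row_index m h) : Gam m h.*2 :=
  let: (x, i, t, o) := j in ((x *+ 2, inZp (t * h + i.*2 + o))%R, t).

Lemma row_leftM (m h : nat) (j : row_index m h) :
  dih_op (row_left j) (row_right j) = row_prod j.
Proof.
case: j => [[[x i] t] []]; rewrite /dih_op /= ?opprK -inZpD -mulr2n.
  by congr (_, inZp _, _); [lia|case: t].
by congr (_, inZp _, _); [lia|case: t].
Qed.

Lemma inZp_inj (q a b : nat) :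
  a < q -> b < q -> inZp a = inZp b :> 'I_q.-1.+1 -> a = b.
Proof. by move=> lt_a lt_b [] /=; rewrite !modn_small; lia. Qed.

Lemma row_left_inj (m h : nat) : injective (@row_left m h).
Proof.
move=> [[[x [i lt_i]] t] o] [[[x' [i' lt_i']] t'] o'] E.
have [-> /inZp_inj E2 ->] : [/\ x = x',
  inZp (t * h + i) = inZp (t' * h + i') :> 'I_h.*2.-1.+1 & o = o']
  by split; [exact: (congr1 (fun z : Gam m h.*2 => z.1.1) E)
    |exact: (congr1 (fun z : Gam m h.*2 => z.1.2) E)
    |exact: (congr1 (fun z : Gam m h.*2 => z.2) E)].
have {E E2} E : t * h + i = t' * h + i'.
  by apply: E2; case: t t' {E} => [] []; lia.
have -> : t = t' by case: t t' E => [] []; lia.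
by congr (_, _, _, _); apply: val_inj => /=; case: t t' E => [] []; lia.
Qed.

Lemma row_right_inj (m h : nat) : injective (@row_right m h).
Proof.
move=> [[[x [i lt_i]] t] o] [[[x' [i' lt_i']] t'] o'] E.
have {E} [E1 E2 E3] : [/\ (if o then - x else x) = (if o' then - x' else x'),
  (if o then - inZp i.+1 else inZp i)
    = (if o' then - inZp i'.+1 else inZp i') :> 'I_h.*2.-1.+1
  & t (+) o = t' (+) o']%R
  by split; [exact: (congr1 (fun z : Gam m h.*2 => z.1.1) E)
    |exact: (congr1 (fun z : Gam m h.*2 => z.1.2) E)
    |exact: (congr1 (fun z : Gam m h.*2 => z.2) E)].
(* The residues [b] and [-(a + 1)] lie in opposite halves of [Z_2h]. *)
have no_mix a b : a < h -> b < h ->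
    (- inZp a.+1)%R <> inZp b :> 'I_h.*2.-1.+1.
  move=> lt_a lt_b /eqP; rewrite eq_sym -subr_eq0 opprK -inZpD inZp_eq0.
  by rewrite gtnNdvd //; lia.
case: o o' E1 E2 E3 => [] [] E1 E2; rewrite ?addbT ?addbF => E3.
- rewrite (negb_inj E3) (oppr_inj E1).
  have := inZp_inj _ _ (oppr_inj E2) => H.
  by congr (_, _, _, _); apply: val_inj => /=; lia.
- by case: (no_mix i i').
- by case: (no_mix i' i).
rewrite E3 E1.
have := inZp_inj _ _ E2 => H.
by congr (_, _, _, _); apply: val_inj => /=; lia.
Qed.

Lemma mulr2n_inj_Zp (m : nat) : odd m -> injective (fun x : 'I_m.-1.+1 => x *+ 2)%R.
Proof.
move=> odd_m x y /eqP; rewrite -subr_eq0 -mulrnBl => /eqP E.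
apply/eqP; rewrite -subr_eq0; move: (x - y)%R E => z.
rewrite -{1}(valZpK z) inZp_mulrn => /eqP; rewrite inZp_eq0.
rewrite Gauss_dvdl; last by rewrite coprimen2; case: m odd_m {x y z}.
by rewrite -inZp_eq0 valZpK.
Qed.

Lemma row_prod_inj (m h : nat) : odd m -> injective (@row_prod m h).
Proof.
move=> odd_m [[[x [i lt_i]] t] o] [[[x' [i' lt_i']] t'] o'] E.
have {E} [/(mulr2n_inj_Zp odd_m)-> + Et] : [/\ x *+ 2 = x' *+ 2,
  inZp (t * h + i.*2 + o) = inZp (t' * h + i'.*2 + o') :> 'I_h.*2.-1.+1
  & t = t']%R
  by split; [exact: (congr1 (fun z : Gam m h.*2 => z.1.1) E)
    |exact: (congr1 (fun z : Gam m h.*2 => z.1.2) E)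
    |exact: (congr1 (fun z : Gam m h.*2 => z.2) E)].
rewrite Et -!addnA [in LHS]inZpD [in RHS]inZpD => /addrI H.
have {H} E := inZp_inj _ _ H.
have {}E : i.*2 + o = i'.*2 + o' by apply: E; lia.
have -> : o = o' by move: E; case: o o' => [] []; lia.
congr (_, _, _, _); apply: val_inj => /=; lia.
Qed.

Lemma card_row_index (m h : nat) : 0 < m -> 0 < h -> #|row_index m h| = #|Gam m h.*2|.
Proof.
move=> m_gt0 h_gt0; rewrite card_Gam; try lia.
by rewrite !card_prod !card_ord card_bool prednK; nia.
Qed.

Lemma complete_mapping (m h : nat) : odd m -> 0 < h ->
  exists a b : {perm Gam m h.*2}, forall x, dih_op (a x) (b x) = x.
Proof.
move=> odd_m h_gt0; have m_gt0 := odd_gt0 odd_m.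
have le_card : #|Gam m h.*2| <= #|row_index m h| by rewrite card_row_index.
have p_inj := row_prod_inj (h := h) odd_m.
have [a aP] := perm_between_inj le_card p_inj (@row_left_inj m h).
have [b bP] := perm_between_inj le_card p_inj (@row_right_inj m h).
exists a, b => x; have [q _ qK] := inj_card_bij p_inj le_card.
by rewrite -(qK x) aP bP row_leftM.
Qed.

(* Three rows of the complete mapping are altered by exchanging two left and two
   right entries; the two reflections among the three products are exchanged. *)
Lemma near_complete_mapping (m h : nat) : odd m -> 0 < h ->
  exists (a b : {perm Gam m h.*2}) (q : rot_group m h.*2), forall x,
    dih_op (a x) (b x) =
    if x == (q, false) then ((q + (second_gen m h.*2 2 - first_gen m h.*2 8))%R, false)
    else x.
Proof.
move=> odd_m h_gt0; have m_gt0 := odd_gt0 odd_m.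
have le_card : #|Gam m h.*2| <= #|row_index m h| by rewrite card_row_index.
have lt_pred : h.-1 < h by rewrite prednK.
pose w : 'I_m.-1.+1 := inZp 1.
(* The products of [i0], [j0], [l0] are the rotation (6,-2) and the reflections (-2,h) and (2,h-1).
   After the exchanges they are (-2,0), (2,h-1) and (-2,h), so only the first changes as a value, by
   (-8,2). *)
pose i0 : row_index m h := (w *+ 3, Ordinal lt_pred, false, false)%R.
pose j0 : row_index m h := (- w, Ordinal h_gt0, true, false)%R.
pose l0 : row_index m h := (w, Ordinal lt_pred, true, true)%R.
have p_inj : injective (@row_prod m h \o tperm j0 l0).
  by apply: inj_comp (row_prod_inj odd_m) perm_inj.
have a_inj : injective (@row_left m h \o tperm i0 j0).
  by apply: inj_comp (@row_left_inj m h) perm_inj.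
have b_inj : injective (@row_right m h \o tperm i0 l0).
  by apply: inj_comp (@row_right_inj m h) perm_inj.
have [a aP] := perm_between_inj le_card p_inj a_inj.
have [b bP] := perm_between_inj le_card p_inj b_inj.
have ne_ij : i0 != j0 by rewrite !xpair_eqE /= andbF.
have ne_il : i0 != l0 by rewrite !xpair_eqE /= andbF.
have ne_jl : j0 != l0 by rewrite !xpair_eqE /= andbF.
(* Writing 0 as [2h] turns the congruences below into equalities of natural numbers. *)
have N0 : inZp h.*2 = 0%R :> 'I_h.*2.-1.+1.
  by apply/eqP; rewrite inZp_eq0 prednK ?double_gt0.
exists a, b, (row_prod i0).1 => x; have [q _ qK] := inj_card_bij p_inj le_card.
rewrite -(qK x) aP bP; move: (q x) => j {x q qK aP bP}.
have -> : ((row_prod i0).1, false) = (@row_prod m h \o tperm j0 l0) i0.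
  by rewrite /= tpermD // eq_sym.
rewrite (inj_eq p_inj) /=.
have [->|ne_i0] := eqVneq j i0.
  rewrite !tpermL /dih_op /=; congr (_, _, _).
    rewrite /= sub0r -mulrnA -[inZp 8]/(inZp (1 * 8)) -inZp_mulrn -/w.
    by rewrite -[RHS]opprB -mulrnBr // -opprD.
  rewrite /= [h.-1.+1](prednK h_gt0) mul1n addn0 subrr subr0 mul0n add0n addn0 -inZpD -N0.
  by congr (inZp _); lia.
have [->|ne_j0] := eqVneq j j0.
  rewrite tpermR tpermL (tpermD ne_ij) 1?eq_sym // /dih_op /=.
  congr (_, _, _).
    by rewrite mulrSr addrK.
  by rewrite -[LHS]addr0 -N0 -!inZpD; congr (inZp _); lia.
have [->|ne_l0] := eqVneq j l0.
  rewrite !tpermR tpermD // /dih_op /=.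
  congr (_, _, _).
    by rewrite mulrS opprD addNKr mulNrn.
  by rewrite inZpD addrK; congr (inZp _); lia.
by rewrite !tpermD 1?eq_sym // row_leftM.
Qed.

(** * Assembling the columns *)

Lemma dih_op_rotation (m N : nat) (x y : rot_group m N) :
  dih_op ((x, false) : Gam m N) (y, false) = ((x + y)%R, false).
Proof. by case: x y => [x1 x2] [y1 y2]. Qed.

Lemma dih_op_reflection (m N : nat) (x y : rot_group m N) :
  dih_op ((x, true) : Gam m N) (y, true) = ((x - y)%R, false).
Proof. by case: x y => [x1 x2] [y1 y2]. Qed.

Lemma dih_sum_cons (m N : nat) (x : Gam m N) (s : seq (Gam m N)) :
  dih_sum (x :: s) = foldl (@dih_op m N) x s.
Proof. by case: x => [[x y] t]; rewrite /dih_sum /= !add0r. Qed.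

Lemma dih_sum_cons2 (m N : nat) (x y : Gam m N) (s : seq (Gam m N)) :
  dih_sum [:: x, y & s] = foldl (@dih_op m N) (dih_op x y) s.
Proof. exact: dih_sum_cons. Qed.

Lemma card_by_sign (T : finType) (p1 p2 : {set T}) :
  #|[pred x : T * bool | if x.2 then x.1 \in p2 else x.1 \in p1]| = #|p1| + #|p2|.
Proof.
have -> : #|[pred x : T * bool | if x.2 then x.1 \in p2 else x.1 \in p1]|
  = #|[set (x, false) | x in p1] :|: [set (x, true) | x in p2]|.
  apply: eq_card => -[x []]; rewrite !inE /=; apply/idP/orP.
  - by move=> xp; right; apply: imset_f.
  - by case=> /imsetP[y yp []] // ->.
  - by move=> xp; left; apply: imset_f.
  - by case=> /imsetP[y yp []] // ->.
rewrite cardsU !card_imset; try by move=> x y [].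
rewrite (_ : _ :&: _ = set0) ?cards0 ?subn0 //.
by apply/setP => x; rewrite !inE; apply/negP => /andP[/imsetP[y _ ->] /imsetP[z _ []]].
Qed.

(* The translation parameter [q - (xs + e1 xs)] places the altered product [q]
   in the row indexed by [xs]. *)
Lemma three_columns (m N : nat) (a b : {perm Gam m N}) (q d xs : rot_group m N)
    (e1 e2 : rot_group m N -> rot_group m N) :
  (forall x, dih_op (a x) (b x) = if x == (q, false) then ((q + d)%R, false) else x) ->
  injective (fun x => x + e1 x)%R -> injective (fun x => x + e2 x)%R ->
  exists cs : 3.-tuple {perm Gam m N}, forall x : Gam m N,
    dih_sum [seq (c : {perm Gam m N}) x | c <- cs] =
    if x.2 then (e2 x.1, false)
    else ((if x.1 == xs then e1 x.1 + d else e1 x.1)%R, false).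
Proof.
move=> abP e1_inj e2_inj; pose s := (q - (xs + e1 xs))%R.
pose f (x : Gam m N) : Gam m N :=
  if x.2 then ((x.1 + e2 x.1)%R, true) else ((x.1 + e1 x.1 + s)%R, false).
have f_inj : injective f.
  move=> [x []] [y []] // E; congr (_, _).
    exact: e2_inj (congr1 fst E).
  exact: e1_inj (addIr s (congr1 fst E)).
(* The first two columns multiply to [f], up to the altered product. On rotations the third entry
   cancels [x + s]; on reflections it is [x] itself, and two reflections multiply to the difference
   [e2 x]. *)
pose c (x : Gam m N) : Gam m N := if x.2 then x else ((- x.1 - s)%R, false).
have c_inj : injective c.
  move=> [x []] [y []] // E; congr (_, _).
  exact: oppr_inj (addIr (- s)%R (congr1 fst E)).
exists [tuple (perm f_inj * a)%g; (perm f_inj * b)%g; perm c_inj] => x.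
rewrite [map _ _]/= dih_sum_cons2 !permM !permE abP /foldl.
case: x => [x []]; rewrite /f /c /=.
  by rewrite xpair_eqE andbF dih_op_reflection addrC addKr.
rewrite xpair_eqE andbT.
have -> : ((x + e1 x + s)%R == q) = (x == xs).
  by rewrite addrCA -[X in _ == X]addr0 (inj_eq (addrI q)) subr_eq0 (inj_eq e1_inj).
case: eqP => [->|_]; rewrite dih_op_rotation; congr (_, _).
  by rewrite /s opprB -[(xs + _ - q)%R]addrA addKr [LHS]addrC addrA subrK.
by rewrite [(x + e1 x)%R]addrC -[(_ + x + s)%R]addrA -opprD addrK.
Qed.

Lemma add_column (m h g : nat) (cs : g.+1.-tuple {perm Gam m h.*2}) :
  odd m -> 0 < h ->
  exists cs' : g.+2.-tuple {perm Gam m h.*2}, forall x,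
    dih_sum [seq (c : {perm Gam m h.*2}) x | c <- cs'] =
    dih_sum [seq (c : {perm Gam m h.*2}) x | c <- cs].
Proof.
move=> odd_m h_gt0; have [a [b abP]] := complete_mapping odd_m h_gt0.
case/tupleP: cs => c cs; exists [tuple of (c * a)%g :: (c * b)%g :: cs] => x.
rewrite [map _ _]/= dih_sum_cons2 !permM abP.
by rewrite [map _ (_ :: _)]/= dih_sum_cons.
Qed.

Lemma columns_with_orders (m h alpha : nat) :
  odd m -> 0 < h -> alpha <= m * h.*2 * 2 ->
  exists (cs : 3.-tuple {perm Gam m h.*2}) (p : pred (Gam m h.*2)),
    #|p| = alpha /\
    forall x, dih_order (dih_sum [seq (c : {perm Gam m h.*2}) x | c <- cs])
              = if p x then m else h.
Proof.
move=> odd_m h_gt0 le_alpha; have m_gt0 := odd_gt0 odd_m.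
have N_gt0 : 0 < h.*2 by lia.
pose M := m * h.*2.
have even_M : M = (m * h).*2 by rewrite /M; lia.
case: (boolP (odd alpha)) => odd_alpha; last first.
  (* Fill the rotation block first; [M] is even, so both blocks receive an even number of rows of
     order [m]. *)
  pose r1 := (minn alpha M)./2; pose r2 := (alpha - r1.*2)./2.
  have [e1 [p1 [e1_inj e1P card_p1 _]]] :=
    @displacement_block m h r1 odd_m h_gt0 ltac:(lia).
  have [e2 [p2 [e2_inj e2P card_p2 _]]] :=
    @displacement_block m h r2 odd_m h_gt0 ltac:(lia).
  have [a [b abP]] := complete_mapping odd_m h_gt0.
  (* A complete mapping is the case of zero alteration. *)
  have abP0 x : dih_op (a x) (b x) =
      if x == ((0 : rot_group m h.*2), false)%R then ((0 + 0)%R, false) else x.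
    by rewrite abP addr0; case: eqP.
  have [cs csP] := three_columns (0 : rot_group m h.*2)%R abP0 e1_inj e2_inj.
  exists cs, [pred x | if x.2 then x.1 \in p2 else x.1 \in p1]; split.
    by rewrite card_by_sign card_p1 card_p2; lia.
  move=> [x t]; rewrite csP /= addr0 if_same; case: t; [exact: e2P|exact: e1P].
(* The cap [M - 2] leaves the rotation block a row with sum [(0,-2)] to alter; the reflections still
   have room, as [alpha - 1] is at most [2M - 2]. *)
pose r1 := (minn alpha.-1 (M - 2))./2; pose r2 := (alpha.-1 - r1.*2)./2.
have [e1 [p1 [e1_inj e1P card_p1 ex_xs]]] :=
  @displacement_block m h r1 odd_m h_gt0 ltac:(lia).
have [e2 [p2 [e2_inj e2P card_p2 _]]] :=
  @displacement_block m h r2 odd_m h_gt0 ltac:(lia).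
have [xs xs_p e1_xs] := ex_xs ltac:(lia).
have [a [b [q abP]]] := near_complete_mapping odd_m h_gt0.
have [cs csP] := three_columns xs abP e1_inj e2_inj.
exists cs, [pred x | if x.2 then x.1 \in p2 else x.1 \in xs |: p1]; split.
  by rewrite card_by_sign cardsU1 xs_p card_p1 card_p2; lia.
move=> [x t]; rewrite csP /=; case: t; first exact: e2P.
rewrite in_setU1; case: eqP => [->|_]; last exact: e1P.
rewrite e1_xs addKr.
have co_m8 : coprime m 8 by rewrite -[8]/(2 ^ 3) coprimeXr ?coprimen2.
by have [_ ->] := order_first_gen m_gt0 N_gt0 co_m8.
Qed.

Theorem mainTheorem9 (g k m n alpha beta : nat) :
  3 <= g -> odd m -> odd n ->
  ~ ((2 <= k /\ beta = 0) \/
     (k = 1 /\ (alpha \in [:: 0; 2; 4] \/ beta \in [:: 0; 2; 4]))) ->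
  (RSM [set: Gam m (2 ^ k.+1 * n)] g (nseq alpha m ++ nseq beta (2 ^ k * n))
   <-> alpha + beta = 2 ^ (k + 2) * m * n).
Proof.
move=> g_ge3 odd_m odd_n _; have m_gt0 := odd_gt0 odd_m.
have h_gt0 : 0 < 2 ^ k * n by rewrite muln_gt0 expn_gt0 (odd_gt0 odd_n).
have -> : 2 ^ k.+1 * n = (2 ^ k * n).*2 by rewrite expnS -mulnA mul2n.
have -> : 2 ^ (k + 2) * m * n = m * (2 ^ k * n).*2 * 2.
  by rewrite expnD (_ : 2 ^ 2 = 4) //; move: (2 ^ k) => x; nia.
move: (2 ^ k * n) h_gt0 => h h_gt0.
have card_G : #|Gam m h.*2| = m * h.*2 * 2 by rewrite card_Gam // double_gt0.
split=> [[A [_ /perm_size]]|card_L].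
  by rewrite size_map size_cat !size_nseq size_enum_ord cardsT card_G.
have le_alpha : alpha <= m * h.*2 * 2 by lia.
have [cs [p [card_p csP]]] := columns_with_orders odd_m h_gt0 le_alpha.
have {cs csP} [cs csP] : exists cs : g.-tuple {perm Gam m h.*2},
    forall x, dih_order (dih_sum [seq (c : {perm Gam m h.*2}) x | c <- cs])
              = if p x then m else h.
  rewrite -(subnKC g_ge3); elim: (g - 3) => [|d [cs' IH]]; first by exists cs.
  rewrite addnS; have [cs'' eq_sum] := add_column cs' odd_m h_gt0.
  by exists cs'' => x; rewrite eq_sum.
have := RSM_of_perms csP.
by rewrite card_p card_G -card_L addKn.
Qed.
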